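(* Let $\{F_n\}_{n\ge 0}$ be the Fibonacci sequence initialized by $F_0=F_1=1$. For every $n\ge 3$: $s_n^k(123,132,213)=0$ for all $3\le k\le n$; $s_n^2(123,132,213)=F_{\frac{n-2}{2}}^2$ if $n$ is even and $0$ if $n$ is odd; $s_n^1(123,132,213)=F_{\frac{n-1}{2}}^2$ if $n$ is odd and $0$ if $n$ is even; and $$s_n^0(123,132,213)=\begin{cases}F_n-F_{\frac{n-2}{2}}^2 & \text{if } n \text{ is even},\\[4pt] F_n-F_{\frac{n-1}{2}}^2 & \text{if } n \text{ is odd}.\end{cases}$$
   Context: $S_n$ denotes the set of permutations of $\{1,\dots,n\}$ written in one-line notation $\pi=\pi_1\pi_2\cdots\pi_n$. For $\alpha\in S_m$, $\pi\in S_n$ contains the pattern $\alpha$ if there are indices $i_1<i_2<\dots<i_m$ such that $\pi_{i_1}\pi_{i_2}\cdots\pi_{i_m}$ is order-isomorphic to $\alpha$; otherwise $\pi$ avoids $\alpha$. For a set $T$ of patterns, $S_n^k(T)$ is the set of $\pi\in S_n$ that have exactly $k$ fixed points (indices $i$ with $\pi_i=i$) and avoid every pattern in $T$; $s_n^k(T)=|S_n^k(T)|$. The braces around $T$ are omitted, e.g. $s_n^k(123,132,213)=s_n^k(\{123,132,213\})$. The Fibonacci numbers satisfy $F_n=F_{n-1}+F_{n-2}$ for $n\ge 2$. *)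

(* Defs.v *)
From mathcomp Require Import all_boot all_order all_algebra all_fingroup.

Set Implicit Arguments.
Unset Strict Implicit.
Unset Printing Implicit Defensive.

(* Permutations of {1, ..., n} are elements of 'S_n, i.e. permutations of
   {0, ..., n-1}: positions and values are both shifted by one, which preserves
   pattern containment and fixed points. *)

Definition one_line n (p : 'S_n) : seq nat :=
  [seq (nat_of_ord (p i)).+1 | i <- enum 'I_n].

Definition contains m n (a : 'S_m) (p : 'S_n) : bool :=
  [exists f : {ffun 'I_m -> 'I_n},
    [forall i : 'I_m, forall j : 'I_m, (i < j) ==> (f i < f j)] &&
    [forall i : 'I_m, forall j : 'I_m, (p (f i) < p (f j)) == (a i < a j)]].

(* Patterns of arbitrary sizes; a set of patterns is represented by a list, of
   which only membership matters. *)
Definition pattern : Type := {m : nat & 'S_m}.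

Definition avoids n (T : seq pattern) (p : 'S_n) : bool :=
  all (fun a : pattern => ~~ contains (projT2 a) p) T.

Definition fixed_points n (p : 'S_n) : {set 'I_n} := [set i | p i == i].

Definition Savoid n k (T : seq pattern) : {set 'S_n} :=
  [set p | (#|fixed_points p| == k) && avoids T p].

Definition savoid n k (T : seq pattern) : nat := #|Savoid n k T|.

Definition perm123 : 'S_3 := 1%g.
Definition perm132 : 'S_3 := tperm (inord 1) (inord 2).
Definition perm213 : 'S_3 := tperm (inord 0) (inord 1).

Lemma one_line_perm123 : one_line perm123 = [:: 1; 2; 3].
Proof.
by rewrite /one_line !enum_ordSl enum_ord0 /= !perm1.
Qed.

Lemma one_line_perm132 : one_line perm132 = [:: 1; 3; 2].
Proof.
rewrite /one_line !enum_ordSl enum_ord0 /= !permE /=.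
by rewrite -!val_eqE /= !inordK.
Qed.

Lemma one_line_perm213 : one_line perm213 = [:: 2; 1; 3].
Proof.
rewrite /one_line !enum_ordSl enum_ord0 /= !permE /=.
by rewrite -!val_eqE /= !inordK.
Qed.

Definition patterns_123_132_213 : seq pattern :=
  [:: existT _ 3 perm123; existT _ 3 perm132; existT _ 3 perm213].

(* Fibonacci numbers indexed so that F_2 = 2, not F_2 = 1. *)
Fixpoint fib (n : nat) : nat :=
  match n with
  | 0 => 1
  | n'.+1 => match n' with 0 => 1 | n''.+1 => fib n' + fib n'' end
  end.

(* Main.v *)
Require Import Defs.
From mathcomp Require Import all_boot all_order all_algebra all_fingroup.
From mathcomp Require Import zify.

Set Implicit Arguments.
Unset Strict Implicit.
Unset Printing Implicit Defensive.

Local Open Scope group_scope.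
Local Open Scope nat_scope.

(** The patterns 123, 132, 213 are exactly the elements of S_3 whose first
entry is smaller than the last one.  Hence [p] avoids all three iff [p k < p i]
whenever [i + 2 <= k] ([avoids_sparseP]): an ascent between non-adjacent
positions, together with any entry in between, forms one of the patterns, and
each pattern contains such an ascent.

Composing with the reversal of values, [q i = n - 1 - p i], turns this into
[q i < q k] whenever [i + 2 <= k].  Counting the positions at least two to the
right (or left) of [i] shows that this is the same as [|q i - i| <= 1] for all
[i] ([tight_monoP]).  Such a [q] is a product of disjoint transpositions of
neighbours, so it is an involution ([tight_invol]).

A fixed point of [p] is a solution of [q i = n - 1 - i].  With [|q i - i| <= 1]
it must be one of the central positions [lo = (n-1)/2] and [hi = n/2] (rounded
down), which coincide for odd [n]; and since [q] is an involution, both are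
solutions or none, according to whether [q lo = hi].  So [p] has one fixed point
(n odd) or two (n even) if [q lo = hi], and none otherwise
([card_antifixed]).

It remains to count.  A permutation of displacement at most 1 starts with a
fixed point or with a transposition of the first two points; removing it gives
the Fibonacci recursion ([card_tight_peel]), hence [fib n] of them in all
([card_tight]).  If [q lo = hi] is prescribed, the permutation splits at the
centre into two independent halves of size [lo], whence [fib lo ^ 2]
([card_tight_central]): peeling points off the left of the centre satisfies the
same recursion and gives the factor [fib lo], and what remains is a
permutation with a prescribed first value. *)

(** * Permutations of displacement at most one *)

Definition tight n (q : 'S_n) : bool :=
  [forall i, (q i <= i.+1) && (i <= (q i).+1)].

(** [a] and [c] are plain numbers, so that the predicate can be transported
between symmetric groups of different sizes. *)
Definition sends n (a c : nat) (q : 'S_n) : bool :=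
  [exists i : 'I_n, (i == a :> nat) && (q i == c :> nat)].

Lemma tightP n (q : 'S_n) :
  reflect (forall i, q i <= i.+1 /\ i <= (q i).+1) (tight q).
Proof.
by apply: (iffP forallP) => h i; [case/andP: (h i) | apply/andP; apply: h].
Qed.

Lemma sendsE n (a : 'I_n) c (q : 'S_n) : sends a c q = (q a == c :> nat).
Proof.
apply/existsP/idP => [[i /andP[/eqP/val_inj -> //]]|h].
by exists a; rewrite eqxx.
Qed.

Lemma tightV n (q : 'S_n) : tight q -> tight q^-1.
Proof.
by move/tightP=> tq; apply/tightP=> i; have := tq (q^-1 i); rewrite permKV => -[].
Qed.

(** The preimage [k] of [i] is [i - 1], [i] or [i + 1].  It is not [i], and
[k = i - 1] would give [q i = i - 1] by induction from the left. *)
Lemma tight_swap n (q : 'S_n) (i j : 'I_n) :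
  tight q -> q i = j -> j = i.+1 :> nat -> q j = i.
Proof.
move=> /tightP tq; have [m] := ubnP (nat_of_ord i).
elim: m i j => // m IHm i j lt_im qi ji.
have [/= h1 h2] := tq (q^-1 i); have := permKV q i; move: h1 h2.
move: (q^-1 i) => k; move=> h1 h2 qk; rewrite qk in h1 h2.
have [ki|ki] := eqVneq k i; first by move: qk ji; rewrite ki qi => ->; lia.
have [kj|kj] := eqVneq k j; first by rewrite -kj.
have {}ki : nat_of_ord k != i by rewrite val_eqE.
have {}kj : nat_of_ord k != j by rewrite val_eqE.
have e : i = k.+1 :> nat by lia.
have qik : q i = k by apply: IHm e => //; lia.
by move: ji; rewrite -qi qik; lia.
Qed.

(** For a descent [q i = i - 1], [tight_swap] is applied to the inverse, which is
tight as well. *)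
Lemma tight_invol n (q : 'S_n) (i : 'I_n) : tight q -> q (q i) = i.
Proof.
move=> tq; have [h1 h2] := tightP _ tq i.
have [e|e] := eqVneq (q i) i; first by rewrite !e.
have {}e : nat_of_ord (q i) != i by rewrite val_eqE.
have [lt|le] := ltnP i (q i); first by apply: tight_swap tq _ _ => //; lia.
have V : q^-1 (q i) = i by rewrite permK.
have /(congr1 q) := tight_swap (tightV tq) V ltac:(lia).
by rewrite permKV.
Qed.

Lemma card_ord_lt n m : m <= n -> #|[set v : 'I_n | v < m]| = m.
Proof.
by move=> le_mn; rewrite -sum1dep_card (big_ord_narrow le_mn) sum1_card card_ord.
Qed.

Lemma card_ord_ge n m : #|[set v : 'I_n | m <= v]| = n - m.
Proof.
have [le_mn|lt_nm] := leqP m n; last first.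
  rewrite (_ : [set _ | _] = set0) ?cards0; first lia.
  by apply/setP=> v; rewrite !inE; have := ltn_ord v; lia.
have := cardsC [set v : 'I_n | v < m]; rewrite card_ord card_ord_lt //.
rewrite (_ : ~: _ = [set v : 'I_n | m <= v]); first lia.
by apply/setP=> v; rewrite !inE -leqNgt.
Qed.

(** From right to left: [q] maps the [n - (i + 2)] positions beyond [i + 1] to
values above [q i], so [q i] is at most [i + 1]; the lower bound is symmetric.
From left to right, displacements at most 1 cannot reverse the order of two
points at distance at least 2. *)
Lemma tight_monoP n (q : 'S_n) :
  reflect (forall i k : 'I_n, i.+2 <= k -> q i < q k) (tight q).
Proof.
apply: (iffP (tightP q)) => [tq i k lt_ik|mono i].
  have [h1 _] := tq i; have [_ h2] := tq k.
  have : nat_of_ord (q i) != q k; last lia.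
  by rewrite val_eqE (inj_eq perm_inj) -val_eqE; apply/eqP=> /= e; lia.
have ub : q @: [set k : 'I_n | i.+2 <= k] \subset [set v : 'I_n | (q i).+1 <= v].
  by apply/subsetP=> v /imsetP[k]; rewrite !inE => /mono ? ->.
have lb : q @: [set k : 'I_n | k < i.-1] \subset [set v : 'I_n | v < q i].
  by apply/subsetP=> v /imsetP[k]; rewrite !inE => h ->; apply: mono; lia.
have := subset_leq_card ub; have := subset_leq_card lb.
have li := ltn_ord i; have lq := ltn_ord (q i).
rewrite !(card_imset _ (@perm_inj _ q)) !card_ord_ge !card_ord_lt; lia.
Qed.

(** * Avoiding 123, 132 and 213 *)

Lemma contains_sparse_ascent n (a : 'S_3) (p : 'S_n) :
  a (inord 0) < a (inord 2) -> contains a p ->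
  exists i k : 'I_n, i.+2 <= k /\ p i < p k.
Proof.
move=> a02 /existsP[f /andP[/forallP mono /forallP iso]].
exists (f (inord 0)), (f (inord 2)).
have mono' (x y : 'I_3) : x < y -> f x < f y by move/(implyP (forallP (mono x) y)).
split; last by have /eqP := forallP (iso (inord 0)) (inord 2); rewrite a02.
have := mono' (inord 0) (inord 1); have := mono' (inord 1) (inord 2).
rewrite !inordK //; lia.
Qed.

(** An occurrence of a pattern of length 3 only has to be checked on the three
increasing pairs of positions; the others follow by injectivity. *)
Lemma triple_contains n (a : 'S_3) (p : 'S_n) (i j k : 'I_n) :
    i < j -> j < k ->
    (p i < p j) = (a (inord 0) < a (inord 1)) ->
    (p i < p k) = (a (inord 0) < a (inord 2)) ->
    (p j < p k) = (a (inord 1) < a (inord 2)) ->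
  contains a p.
Proof.
move=> ij jk e01 e02 e12.
have flip m (s : 'S_m) (x y : 'I_m) : x < y -> (s y < s x) = ~~ (s x < s y).
  move=> xy; have : nat_of_ord (s x) != s y; last lia.
  by rewrite val_eqE (inj_eq perm_inj) -val_eqE /=; lia.
pose f := [ffun x : 'I_3 => nth i [:: i; j; k] x].
have ord3 (x : 'I_3) : [\/ x = inord 0, x = inord 1 | x = inord 2].
  case: x => [[|[|[|//]]] lt_x3]; [apply: Or31 | apply: Or32 | apply: Or33];
  by apply: val_inj; rewrite /= inordK.
have f0 : f (inord 0) = i by rewrite ffunE inordK.
have f1 : f (inord 1) = j by rewrite ffunE inordK.
have f2 : f (inord 2) = k by rewrite ffunE inordK.
apply/existsP; exists f; apply/andP; split; apply/forallP=> x; apply/forallP=> y.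
  by case: (ord3 x) => ->; case: (ord3 y) => ->;
     rewrite ?f0 ?f1 ?f2 !inordK //=; lia.
have ik := ltn_trans ij jk.
have a10 := flip _ a (inord 0) (inord 1).
have a20 := flip _ a (inord 0) (inord 2).
have a21 := flip _ a (inord 1) (inord 2).
rewrite !inordK // in a10 a20 a21.
case: (ord3 x) => ->; case: (ord3 y) => ->; rewrite ?f0 ?f1 ?f2 ?ltnn //.
- by rewrite e01.
- by rewrite e02.
- by rewrite flip // a10 // e01.
- by rewrite e12.
- by rewrite flip // a20 // e02.
- by rewrite flip // a21 // e12.
Qed.

(** Given [i + 2 <= k] and [p i < p k], comparing the entry at [i + 1] with both
tells which of the three patterns occurs. *)
Lemma avoids_sparseP n (p : 'S_n) :
  reflect (forall i k : 'I_n, i.+2 <= k -> p k < p i)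
          (avoids patterns_123_132_213 p).
Proof.
have v132 : (perm132 (inord 0) = 0 :> nat) * (perm132 (inord 1) = 2 :> nat) *
    (perm132 (inord 2) = 1 :> nat).
  by rewrite /perm132 !permE /= -!val_eqE /= !inordK.
have v213 : (perm213 (inord 0) = 1 :> nat) * (perm213 (inord 1) = 0 :> nat) *
    (perm213 (inord 2) = 2 :> nat).
  by rewrite /perm213 !permE /= -!val_eqE /= !inordK.
have v123 : (perm123 (inord 0) = 0 :> nat) * (perm123 (inord 1) = 1 :> nat) *
    (perm123 (inord 2) = 2 :> nat).
  by rewrite /perm123 !perm1 !inordK.
apply: (iffP allP) => [av i k lt_ik|anti a].
  have [//|le] := ltnP (p k) (p i).
  have ik : p i < p k.
    rewrite ltn_neqAle le andbT val_eqE (inj_eq perm_inj) -val_eqE /=; lia.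
  have lt_jn : i.+1 < n by have := ltn_ord k; lia.
  pose j := Ordinal lt_jn.
  have ij : i < j by rewrite /=.
  have jk : j < k by rewrite /=; lia.
  have nij : nat_of_ord (p i) != p j.
    by rewrite val_eqE (inj_eq perm_inj) -val_eqE /=; lia.
  have njk : nat_of_ord (p j) != p k.
    by rewrite val_eqE (inj_eq perm_inj) -val_eqE /=; lia.
  have P (a : 'S_3) : existT _ 3 a \in patterns_123_132_213 -> ~~ contains a p.
    by move/av.
  have [pij|pji] := ltnP (p i) (p j); last first.
    have /negP[] := P perm213 ltac:(by rewrite !inE eqxx !orbT).
    apply: (triple_contains ij jk); rewrite !v213; lia.
  have [pjk|pkj] := ltnP (p j) (p k).
    have /negP[] := P perm123 ltac:(by rewrite !inE eqxx).
    apply: (triple_contains ij jk); rewrite !v123; lia.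
  have /negP[] := P perm132 ltac:(by rewrite !inE eqxx !orbT).
  apply: (triple_contains ij jk); rewrite !v132; lia.
have bad (b : 'S_3) : b (inord 0) < b (inord 2) -> ~~ contains b p.
  move=> b02; apply/negP=> /(contains_sparse_ascent b02)[i [k [/anti]]]; lia.
rewrite !inE => /or3P[] /eqP -> /=; apply: bad; by rewrite ?v123 ?v132 ?v213.
Qed.

Definition rev_perm n : 'S_n := perm (@rev_ord_inj n).

Lemma rev_permE n (p : 'S_n) i : (p * rev_perm n)%g i = rev_ord (p i).
Proof. by rewrite permM permE. Qed.

Lemma avoids_tight n (p : 'S_n) :
  avoids patterns_123_132_213 p = tight (p * rev_perm n)%g.
Proof.
apply/avoids_sparseP/tight_monoP => h i k /h; rewrite !rev_permE /=;
have := ltn_ord (p i); have := ltn_ord (p k); lia.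
Qed.

(** * Fixed points sit at the centre *)

Lemma fixed_points_rev n (p : 'S_n) :
  fixed_points p = [set i | (p * rev_perm n)%g i == rev_ord i].
Proof.
by apply/setP=> i; rewrite !inE rev_permE (inj_eq rev_ord_inj).
Qed.

(** [q i = n - 1 - i] and [|q i - i| <= 1] force [2 i] to be within 1 of [n - 1].
The two central positions [lo] and [hi] are exchanged by the reversal, so
[q lo = hi] puts [lo] in the set and, by involutivity, also [hi]. *)
Lemma card_antifixed n (q : 'S_n) : 0 < n -> tight q ->
  #|[set i | q i == rev_ord i]| =
  (if odd n then 1 else 2) * sends n.-1./2 n./2 q.
Proof.
move=> n0 tq.
have lt_lo : n.-1./2 < n by lia.
have lt_hi : n./2 < n by lia.
pose lo := Ordinal lt_lo; pose hi := Ordinal lt_hi.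
have -> : sends n.-1./2 n./2 q = (q lo == hi) by apply: (sendsE lo).
have rlo : rev_ord lo = hi by apply: val_inj; rewrite /=; lia.
have rhi : rev_ord hi = lo by apply: val_inj; rewrite /=; lia.
have swap : (q hi == lo) = (q lo == hi).
  by apply/eqP/eqP => <-; apply: tight_invol.
have -> : [set i | q i == rev_ord i] =
    if q lo == hi then [set lo; hi] else set0.
  apply/setP=> i; rewrite !inE.
  have [->|ilo] := eqVneq i lo.
    by rewrite rlo; case: ifP; rewrite ?inE ?eqxx.
  have [->|ihi] := eqVneq i hi.
    by rewrite rhi swap; case: ifP; rewrite ?inE ?eqxx ?orbT.
  have -> : (q i == rev_ord i) = false.
    have [h1 h2] := tightP _ tq i.
    apply/negbTE; rewrite -val_eqE /=; apply/eqP=> e; rewrite e in h1 h2.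
    by move: ilo ihi (ltn_ord i); rewrite -!val_eqE /= => ???; lia.
  by case: ifP; rewrite !inE ?(negbTE ilo) ?(negbTE ihi).
case: ifP => _; rewrite ?cards0 ?muln0 // cards2 -val_eqE /= muln1.
by case: ifP => o; lia.
Qed.

(** The bijection between avoiders and tight permutations is right
multiplication by the reversal. *)
Lemma savoid_tight n k : 0 < n ->
  savoid n k patterns_123_132_213 =
  #|[set q : 'S_n | tight q &
      (if odd n then 1 else 2) * sends n.-1./2 n./2 q == k]|.
Proof.
move=> n0; rewrite -(card_preimset _ (mulIg (rev_perm n))).
apply: eq_card => p; rewrite !inE avoids_tight fixed_points_rev andbC.
by have [t|//] := boolP (tight _); rewrite card_antifixed.
Qed.

(** * Peeling off the first block *)

Definition prepend_fix n (s : 'S_n) : 'S_n.+1 := lift_perm ord0 ord0 s.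
Definition prepend_swap n (s : 'S_n) : 'S_n.+2 :=
  (tperm ord0 (lift ord0 ord0) * prepend_fix (prepend_fix s))%g.

Lemma prepend_fix0 n (s : 'S_n) : prepend_fix s ord0 = ord0.
Proof. exact: lift_perm_id. Qed.

Lemma prepend_fixS n (s : 'S_n) i :
  prepend_fix s (lift ord0 i) = lift ord0 (s i).
Proof. exact: lift_perm_lift. Qed.

Lemma prepend_fix_inj n : injective (@prepend_fix n).
Proof.
move=> s t e; apply/permP=> i; apply: (@lift_inj _ ord0).
by rewrite -!prepend_fixS e.
Qed.

(** Values of [q] at positive positions are never 0, so [unlift] always succeeds
and the default [k] below is never taken. *)
Lemma prepend_fix_onto n (q : 'S_n.+1) :
  q ord0 = ord0 -> exists s, q = prepend_fix s.
Proof.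
move=> q0; pose s k := odflt k (unlift ord0 (q (lift ord0 k))).
have sE k : q (lift ord0 k) = lift ord0 (s k).
  rewrite /s; case: unliftP => [//|]; rewrite -[X in _ = X]q0 => /perm_inj.
  by move/eqP; rewrite eq_sym eq_liftF.
have s_inj : injective s.
  by move=> i j e; apply/(@lift_inj _ ord0)/(@perm_inj _ q); rewrite !sE e.
exists (perm s_inj); apply/permP=> i.
by case: (unliftP ord0 i) => [j|] ->; rewrite ?prepend_fix0 // prepend_fixS permE sE.
Qed.

Lemma tight_prepend_fix n (s : 'S_n) : tight (prepend_fix s) = tight s.
Proof.
apply/tightP/tightP => ts i.
  by have := ts (lift ord0 i); rewrite prepend_fixS !lift0.
case: (unliftP ord0 i) => [j|] ->; last by rewrite prepend_fix0.
by rewrite prepend_fixS !lift0; apply: ts.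
Qed.

Lemma prepend_swap0 n (s : 'S_n) : prepend_swap s ord0 = lift ord0 ord0.
Proof. by rewrite permM tpermL prepend_fixS prepend_fix0. Qed.

Lemma prepend_swap1 n (s : 'S_n) : prepend_swap s (lift ord0 ord0) = ord0.
Proof. by rewrite permM tpermR prepend_fix0. Qed.

Lemma prepend_swapSS n (s : 'S_n) i :
  prepend_swap s (lift ord0 (lift ord0 i)) = lift ord0 (lift ord0 (s i)).
Proof. by rewrite permM tpermD ?prepend_fixS // -val_eqE. Qed.

Lemma prepend_swap_inj n : injective (@prepend_swap n).
Proof. by move=> s t /mulgI/prepend_fix_inj/prepend_fix_inj. Qed.

Lemma prepend_swap_onto n (q : 'S_n.+2) :
  q ord0 = lift ord0 ord0 -> q (lift ord0 ord0) = ord0 ->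
  exists s, q = prepend_swap s.
Proof.
move=> q0 q1; pose r := (tperm ord0 (lift ord0 ord0) * q)%g.
have r0 : r ord0 = ord0 by rewrite permM tpermL.
have [r' e] := prepend_fix_onto r0.
have r'0 : r' ord0 = ord0.
  by apply: (@lift_inj _ ord0); rewrite -prepend_fixS -e permM tpermR.
have [s e'] := prepend_fix_onto r'0.
by exists s; rewrite /prepend_swap -e' -e mulgA tperm2 mul1g.
Qed.

Lemma tight_prepend_swap n (s : 'S_n) : tight (prepend_swap s) = tight s.
Proof.
apply/tightP/tightP => ts i.
  by have := ts (lift ord0 (lift ord0 i)); rewrite prepend_swapSS !lift0.
case: (unliftP ord0 i) => [j|] ->; last by rewrite prepend_swap0.
case: (unliftP ord0 j) => [k|] ->; last by rewrite prepend_swap1.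
by rewrite prepend_swapSS !lift0; apply: ts.
Qed.

(** The two halves of the recursion; [P] is arbitrary so that they serve both
the total count and the counts with a prescribed value. *)
Lemma card_tight_fix0 n (P : pred 'S_n.+1) :
  #|[set q : 'S_n.+1 | tight q & (q ord0 == ord0) && P q]| =
  #|[set s : 'S_n | tight s & P (prepend_fix s)]|.
Proof.
rewrite -(card_imset _ (@prepend_fix_inj n)); apply: eq_card => q; rewrite !inE.
apply/idP/imsetP => [/and3P[tq /eqP/prepend_fix_onto[s qs] Pq]|[s + ->]].
  by exists s; rewrite // inE -tight_prepend_fix -qs tq.
by rewrite inE tight_prepend_fix prepend_fix0 eqxx.
Qed.

Lemma card_tight_swap0 n (P : pred 'S_n.+2) :
  #|[set q : 'S_n.+2 | tight q & (q ord0 != ord0) && P q]| =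
  #|[set s : 'S_n | tight s & P (prepend_swap s)]|.
Proof.
rewrite -(card_imset _ (@prepend_swap_inj n)); apply: eq_card => q; rewrite !inE.
apply/idP/imsetP => [/and3P[tq q0 Pq]|[s + ->]].
  have {}q0 : q ord0 = lift ord0 ord0.
    apply: ord_inj; rewrite lift0; have [/= le_q1 _] := tightP _ tq ord0.
    by move: q0; rewrite -val_eqE /=; lia.
  have [|s qs] := prepend_swap_onto q0; first by rewrite -q0 tight_invol.
  by exists s; rewrite // inE -tight_prepend_swap -qs tq.
by rewrite inE tight_prepend_swap prepend_swap0.
Qed.

(** * Fibonacci counts *)

Lemma card_tight_peel n (P : pred 'S_n.+2) :
  #|[set q : 'S_n.+2 | tight q & P q]| =
  #|[set s : 'S_n.+1 | tight s & P (prepend_fix s)]| +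
  #|[set s : 'S_n | tight s & P (prepend_swap s)]|.
Proof.
rewrite -card_tight_fix0 -card_tight_swap0.
rewrite -(cardsID [set q : 'S_n.+2 | q ord0 == ord0]).
by congr (_ + _); apply: eq_card => q; rewrite !inE;
  case: (tight q); case: (P q); case: (_ == _).
Qed.

Lemma card_tight n : #|[set q : 'S_n | tight q]| = fib n.
Proof.
have triv m : #|[set q : 'S_m | tight q]| = #|[set q : 'S_m | tight q & true]|.
  by apply: eq_card => q; rewrite !inE andbT.
have small m : m <= 1 -> #|[set q : 'S_m | tight q]| = 1.
  move=> m1; rewrite (_ : [set _ | _] = setT).
    by rewrite cardsT card_Sn; case: m m1 => [|[]].
  apply/setP=> q; rewrite !inE; apply/tightP=> i.
    by have := ltn_ord i; have := ltn_ord (q i); lia.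
have [m] := ubnP n; elim: m n => // m IHm [|[|n]] lt_nm; try exact: small.
by rewrite triv card_tight_peel -!triv !IHm //; lia.
Qed.

Lemma sends_fixSS n a c (s : 'S_n) :
  sends a.+1 c.+1 (prepend_fix s) = sends a c s.
Proof.
apply/existsP/existsP => -[i /andP[ia ic]].
  case: (unliftP ord0 i) ia ic => [j|] ->; last by [].
  by rewrite prepend_fixS !lift0 => ja jc; exists j; apply/andP.
by exists (lift ord0 i); rewrite prepend_fixS !lift0; apply/andP.
Qed.

Lemma sends_swapSSSS n a c (s : 'S_n) :
  sends a.+2 c.+2 (prepend_swap s) = sends a c s.
Proof.
apply/existsP/existsP => -[i /andP[ia ic]].
  case: (unliftP ord0 i) ia ic => [j|] ->; last by [].
  case: (unliftP ord0 j) => [k|] ->; last by [].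
  by rewrite prepend_swapSS !lift0 => ja jc; exists k; apply/andP.
by exists (lift ord0 (lift ord0 i)); rewrite prepend_swapSS !lift0; apply/andP.
Qed.

(** Both sides satisfy the Fibonacci recursion in [a]: as long as [a >= 2] either
first block can be peeled off without touching position [a].  At [a = 1] only
the fixed point can, because an initial transposition sends 1 to 0.  The
parameter [y] is 0 or 1 below, for a central fixed point or transposition. *)
Lemma card_tight_sends_shift a n y :
  #|[set q : 'S_(a + n.+1) | tight q & sends a (a + y) q]| =
  fib a * #|[set q : 'S_n.+1 | tight q & sends 0 y q]|.
Proof.
have [m] := ubnP a; elim: m a => // m IHm [|[|a]] lt_am; first by rewrite mul1n.
  rewrite mul1n; rewrite [LHS]card_tight_peel [X in _ + X](_ : _ = 0) ?addn0.
    by apply: eq_card => q; rewrite !inE sends_fixSS.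
  apply: eq_card0 => q; rewrite !inE (sendsE (lift ord0 ord0)) prepend_swap1.
  by rewrite andbF.
rewrite [LHS]card_tight_peel [fib _]/= mulnDl -(IHm a.+1) -?(IHm a); try lia.
by congr (_ + _); apply: eq_card => q; rewrite !inE ?sends_fixSS ?sends_swapSSSS.
Qed.

Lemma card_tight_sends00 b :
  #|[set q : 'S_b.+1 | tight q & sends 0 0 q]| = fib b.
Proof.
transitivity #|[set q : 'S_b.+1 | tight q & (q ord0 == ord0) && true]|.
  by apply: eq_card => q; rewrite !inE (sendsE ord0) andbT -val_eqE.
by rewrite card_tight_fix0 -card_tight; apply: eq_card => s; rewrite !inE andbT.
Qed.

Lemma card_tight_sends01 b :
  #|[set q : 'S_b.+2 | tight q & sends 0 1 q]| = fib b.
Proof.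
rewrite card_tight_peel [X in X + _](_ : _ = 0) => [|/=].
  rewrite add0n -card_tight; apply: eq_card => s; rewrite !inE (sendsE ord0).
  by rewrite prepend_swap0 andbT.
by apply: eq_card0 => s; rewrite !inE (sendsE ord0) prepend_fix0 andbF.
Qed.

(** The centre is a fixed point with [lo] points on each side if [n] is odd, and a
transposition with [lo] points on each side if [n] is even. *)
Lemma card_tight_central n : 0 < n ->
  #|[set q : 'S_n | tight q & sends n.-1./2 n./2 q]| = fib n.-1./2 ^ 2.
Proof.
move=> n0; move ea: n.-1./2 => a.
case o : (odd n).
  have [en ->] : n = a + a.+1 /\ n./2 = a + 0 by lia.
  by rewrite en card_tight_sends_shift card_tight_sends00.
have [en ->] : n = a + a.+2 /\ n./2 = a + 1 by lia.
by rewrite en card_tight_sends_shift card_tight_sends01.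
Qed.

Lemma card_tight_noncentral n : 0 < n ->
  #|[set q : 'S_n | tight q & ~~ sends n.-1./2 n./2 q]|
    + fib n.-1./2 ^ 2 = fib n.
Proof.
move=> n0; rewrite -(card_tight n) -card_tight_central // addnC.
rewrite -(cardsID [set q | sends n.-1./2 n./2 q] [set q | tight q]).
by congr (_ + _); apply: eq_card => q; rewrite !inE // andbC.
Qed.

Theorem theorem3p2 (n : nat) (hn : 3 <= n) :
  [/\ (forall k : nat, 3 <= k <= n -> savoid n k patterns_123_132_213 = 0),
      savoid n 2 patterns_123_132_213 =
        (if odd n then 0 else fib ((n - 2) %/ 2) ^ 2),
      savoid n 1 patterns_123_132_213 =
        (if odd n then fib ((n - 1) %/ 2) ^ 2 else 0) &
      ((savoid n 0%N patterns_123_132_213)%:Z =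
        if odd n then (fib n)%:Z - (fib ((n - 1) %/ 2))%:Z ^+ 2
        else (fib n)%:Z - (fib ((n - 2) %/ 2))%:Z ^+ 2)%R].
Proof.
have n0 : 0 < n by lia.
have nc := card_tight_noncentral n0.
have ce := card_tight_central n0.
have z0 : savoid n 0 patterns_123_132_213 + fib n.-1./2 ^ 2 = fib n.
  rewrite -nc savoid_tight //; congr (_ + _); apply: eq_card => q; rewrite !inE.
  by case: (odd n); case: (sends _ _ q).
split=> [k /andP[k3 _]|||].
- rewrite savoid_tight //; apply: eq_card0 => q; rewrite !inE.
  by case: (odd n); case: (sends _ _ q); rewrite /= andbC; case: eqP k3 => // <-.
- rewrite savoid_tight //; case o: (odd n).
    by apply: eq_card0 => q; rewrite !inE; case: (sends _ _ q); rewrite andbF.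
  rewrite (_ : (n - 2) %/ 2 = n.-1./2) -?ce; last lia.
  by apply: eq_card => q; rewrite !inE; case: (sends _ _ q).
- rewrite savoid_tight //; case o: (odd n).
    rewrite (_ : (n - 1) %/ 2 = n.-1./2) -?ce; last lia.
    by apply: eq_card => q; rewrite !inE; case: (sends _ _ q).
  by apply: eq_card0 => q; rewrite !inE; case: (sends _ _ q); rewrite andbF.
have -> : (if odd n then ((fib n)%:Z - (fib ((n - 1) %/ 2))%:Z ^+ 2)%R
  else ((fib n)%:Z - (fib ((n - 2) %/ 2))%:Z ^+ 2)%R)
  = ((fib n)%:Z - (fib n.-1./2)%:Z ^+ 2)%R.
  have e1 : odd n -> (n - 1) %/ 2 = n.-1./2 by lia.
  have e2 : ~~ odd n -> (n - 2) %/ 2 = n.-1./2 by lia.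
  by case: ifPn => [/e1|/e2] ->.
by rewrite -z0 PoszD -mulnn PoszM GRing.expr2 GRing.addrK.
Qed.
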